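(* For $n\in\mathbb{N}$, $$\sum_{k=0}^{n}\binom{2k}{k}\equiv\begin{cases}(-1)^{\delta_3(n)}\pmod 3&\text{if } n\in 3T(01),\\ 0\pmod 3&\text{otherwise.}\end{cases}$$
   Context: $\delta_3(n)$ denotes the number of digits equal to $1$ in the base-$3$ expansion of $n$. $T(01)$ denotes the set of $m\in\mathbb{N}$ whose base-$3$ expansion contains only digits $0$ and $1$, and $3T(01)=\{3m : m\in T(01)\}$. *)

(* Defs.v *)
From mathcomp Require Import all_boot all_order all_algebra.

Set Implicit Arguments.
Unset Strict Implicit.
Unset Printing Implicit Defensive.

(* The digit of weight 3 ^ i; it is 0 at positions beyond the leading digit. *)
Definition digit3 (n i : nat) : nat := (n %/ 3 ^ i) %% 3.

(* Bounds the positions that delta3 has to inspect. *)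
Lemma digit3_eq0 (n i : nat) : n <= i -> digit3 n i = 0.
Proof.
by move=> le_ni; rewrite /digit3 divn_small // (leq_ltn_trans le_ni) // ltn_expl.
Qed.

(* Positions i >= n carry no digit 1, by digit3_eq0. *)
Definition delta3 (n : nat) : nat := #|[set i : 'I_n | digit3 n i == 1]|.

(* Padding zeros are allowed digits, so quantifying over all positions is
   harmless; in particular T01 0 holds. *)
Definition T01 (m : nat) : Prop := forall i : nat, digit3 m i \in [:: 0; 1].

Definition threeT01 (n : nat) : Prop := exists2 m : nat, T01 m & n = 3 * m.

(* Main.v *)
(* Modulo 3 the central binomial coefficients c k = 'C(2 * k, k) satisfy
   c (3 * m + r) = c m * c r for r < 3, by Lucas' theorem, and (c 0, c 1, c 2)
   is (1, -1, 0).  Hence c m is (-1) ^ delta3 m or 0 according to whether m has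
   only the digits 0 and 1.  Each block c (3 * m) + c (3 * m + 1) + c (3 * m + 2)
   vanishes, and so does its initial part of length 2, so that the sum up to n
   is c m if n = 3 * m and 0 otherwise. *)
Require Import Defs.
From mathcomp Require Import all_boot all_order all_algebra.
From mathcomp Require Import zify.

(** Pascal's rule applied three times gives the coefficients 1, 3, 3, 1, and the middle ones vanish
    modulo 3. *)
Lemma bin_add3_mod3 n k : 'C(n + 3, k + 3) = 'C(n, k + 3) + 'C(n, k) %[mod 3].
Proof. by rewrite !addn3 !binS; lia. Qed.

Lemma bin_add3_small_mod3 n k : k < 3 -> 'C(n + 3, k) = 'C(n, k) %[mod 3].
Proof.
by rewrite !addn3; case: k => [|[|[|//]]] _; rewrite ?binS ?bin0; lia.
Qed.

(** By [bin_add3_mod3], both sides obey Pascal's rule in [a] and [b]; hence induction on [a] for all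
    [b]. *)
Lemma lucas_mod3 a b s t : s < 3 -> t < 3 ->
  'C(3 * a + s, 3 * b + t) = 'C(a, b) * 'C(s, t) %[mod 3].
Proof.
move=> lt_s3 lt_t3; elim: a b => [|a IHa] [|b].
- by rewrite !muln0 !add0n mul1n.
- by rewrite muln0 add0n bin_small ?bin0n //; lia.
- rewrite muln0 add0n (_ : 3 * a.+1 + s = 3 * a + s + 3); last by lia.
  by rewrite bin_add3_small_mod3 //; have := IHa 0; rewrite muln0 !bin0.
rewrite (_ : 3 * a.+1 + s = 3 * a + s + 3); last by lia.
rewrite (_ : 3 * b.+1 + t = 3 * b + t + 3); last by lia.
rewrite bin_add3_mod3 -modnDm IHa.
rewrite (_ : 3 * b + t + 3 = 3 * b.+1 + t); last by lia.
by rewrite IHa modnDm binS mulnDl.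
Qed.

Definition central_bin k := 'C(2 * k, k).

Lemma central_bin_mul3 m : central_bin (3 * m) = central_bin m %[mod 3].
Proof.
have := @lucas_mod3 (2 * m) m 0 0 isT isT.
by rewrite bin0 muln1 !addn0 mulnCA.
Qed.

(** Doubling gives [3 * (2 * m) + 2], so the last digits contribute ['C(2, 1) = 2], which stands for
    -1. *)
Lemma central_bin_mul3_add1 m :
  central_bin (3 * m + 1) = 2 * central_bin m %[mod 3].
Proof.
have := @lucas_mod3 (2 * m) m 2 1 isT isT.
by rewrite bin1 [_ * 2]mulnC mulnCA -[in X in _ + X](muln1 2) -mulnDr.
Qed.

(** Doubling carries: [2 * (3 * m + 2) = 3 * (2 * m).+1 + 1], and ['C(1, 2) = 0]. *)
Lemma central_bin_mul3_add2 m : central_bin (3 * m + 2) = 0 %[mod 3].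
Proof.
have := @lucas_mod3 (2 * m).+1 m 1 2 isT isT.
rewrite (@bin_small 1 2) // muln0 => <-.
by congr ('C(_, _) %% 3); lia.
Qed.

Lemma sum_central_bin_mul3 m :
  \sum_(0 <= k < 3 * m) central_bin k = 0 %[mod 3].
Proof.
elim: m => [|m IHm]; first by rewrite muln0 big_geq.
rewrite (_ : 3 * m.+1 = (3 * m).+3); last by lia.
rewrite !big_nat_recr //=.
have := central_bin_mul3 m; have := central_bin_mul3_add1 m.
have := central_bin_mul3_add2 m; rewrite addn1 addn2; lia.
Qed.

Lemma digit3_mul3_add0 m r : r < 3 -> digit3 (3 * m + r) 0 = r.
Proof. by move=> lt_r3; rewrite /digit3 divn1; lia. Qed.

Lemma digit3_mul3_addS m r i : r < 3 -> digit3 (3 * m + r) i.+1 = digit3 m i.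
Proof.
move=> lt_r3; rewrite /digit3 expnS divnMA.
by congr (_ %/ _ %% _); lia.
Qed.

Lemma T01_mul3_add m r : r < 3 -> T01 (3 * m + r) <-> r < 2 /\ T01 m.
Proof.
move=> lt_r3; split=> [Tmr|[lt_r2 Tm] [|i]].
- split=> [|i]; last by rewrite -(digit3_mul3_addS _ _ i lt_r3); apply: Tmr.
  by have := Tmr 0; rewrite digit3_mul3_add0 // !inE; lia.
- by rewrite digit3_mul3_add0 // !inE; lia.
by rewrite digit3_mul3_addS.
Qed.

(** Frees the count from the bound [n] built into [delta3], so that a number and its quotient by 3
    can be compared over matching ranges. *)
Lemma delta3_widen n N : n <= N -> delta3 n = \sum_(0 <= i < N) (digit3 n i == 1).
Proof.
move=> le_nN; rewrite /delta3 cardsE -sum1_card big_mkcond /=.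
rewrite (big_cat_nat (leq0n n) le_nN) //= big_mkord.
rewrite [X in _ = _ + X]big_nat_cond [X in _ = _ + X]big1 ?addn0.
  by apply: eq_bigr => i _; rewrite unfold_in; case: (digit3 n i) => [|[]].
by move=> i /andP[/andP[le_ni _] _]; rewrite digit3_eq0.
Qed.

Lemma delta3_mul3_add m r : r < 3 -> delta3 (3 * m + r) = (r == 1) + delta3 m.
Proof.
(* The extra position is split off as the last digit; the remaining range still covers the digits of
   [m]. *)
move=> lt_r3; rewrite (@delta3_widen _ (3 * m + r).+1) // big_nat_recl //.
rewrite digit3_mul3_add0 // (@delta3_widen m (3 * m + r)); last by lia.
by congr (_ + _); apply: eq_bigr => i _; rewrite digit3_mul3_addS.
Qed.

(** Strong induction, removing the last digit. The residue 2 replaces -1 so that the argument stays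
    in [nat]. *)
Lemma central_bin_mod3 m :
  (T01 m -> central_bin m = 2 ^ delta3 m %[mod 3]) /\
  (~ T01 m -> central_bin m = 0 %[mod 3]).
Proof.
elim/ltn_ind: m => -[|m] IHm.
  (* Zero is its own quotient by 3, so the induction hypothesis cannot reach it. *)
  rewrite (@delta3_widen 0 0) // big_geq //; split=> // nT0; case: nT0 => i.
  by rewrite digit3_eq0.
have [Tq nTq] := IHm (m.+1 %/ 3) ltac:(lia).
have lt_r3 : m.+1 %% 3 < 3 by rewrite ltn_mod.
rewrite (divn_eq m.+1 3) mulnC T01_mul3_add // delta3_mul3_add //.
move: (m.+1 %/ 3) (m.+1 %% 3) lt_r3 Tq nTq => q [|[|[|//]]] _ Tq nTq.
- rewrite addn0 add0n central_bin_mul3.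
  by split=> [[_ /Tq]|nT] //; apply: nTq => Tq'; case: nT.
- rewrite central_bin_mul3_add1 expnS -[in LHS]modnMmr.
  split=> [[_ /Tq ->]|nT]; first by rewrite modnMmr.
  by rewrite -modnMmr nTq // => Tq'; case: nT.
by rewrite central_bin_mul3_add2; split=> [[]|].
Qed.

Lemma sum_central_bin_mod3 m r : r < 3 ->
  \sum_(0 <= k < (3 * m + r).+1) central_bin k
    = (if r == 0 then central_bin m else 0) %[mod 3].
Proof.
have := sum_central_bin_mul3 m; have := central_bin_mul3 m.
have := central_bin_mul3_add1 m; have := central_bin_mul3_add2 m.
case: r => [|[|[|//]]]; rewrite ?addn0 ?addn1 ?addn2 !big_nat_recr //=; lia.
Qed.

Lemma threeT01_mul3_add m r : r < 3 -> threeT01 (3 * m + r) <-> r = 0 /\ T01 m.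
Proof.
move=> lt_r3; split=> [[q Tq eq_q]|[-> Tm]]; last by exists m; rewrite ?addn0.
by rewrite (_ : m = q); [split=> //|]; lia.
Qed.

(** Links the integer sign to the natural residue: [-1] reduces to 2 modulo 3. *)
Lemma expz_neg1_mod3 d : ((- 1) ^+ d = (2 ^ d)%N%:Z %[mod 3])%Z.
Proof. by rewrite -[in RHS]natz GRing.natrX -(modzXm _ (-1)). Qed.

Theorem theorem5p6 (n : nat) :
  (threeT01 n ->
     ((\sum_(0 <= k < n.+1) 'C(2 * k, k))%N%:Z = (- 1) ^+ delta3 n %[mod 3])%Z)
  /\
  (~ threeT01 n ->
     ((\sum_(0 <= k < n.+1) 'C(2 * k, k))%N%:Z = 0 %[mod 3])%Z).
Proof.
rewrite expz_neg1_mod3 !modz_nat.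
have lt_r3 : n %% 3 < 3 by rewrite ltn_mod.
rewrite (divn_eq n 3) mulnC threeT01_mul3_add // sum_central_bin_mod3 //.
rewrite delta3_mul3_add //; have [Tq nTq] := central_bin_mod3 (n %/ 3).
split=> [[-> Tm]|nT]; first by rewrite Tq.
by case: eqP => // r0; rewrite nTq // => Tm; case: nT.
Qed.
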